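(* The functions $G\mapsto\vartheta(\overline{G})$, $G\mapsto\vartheta'(\overline{G})$, and $G\mapsto\vartheta^+(\overline{G})$ are sandwich functions.
   Context: Graphs are loopless, undirected, and possibly infinite. Let $\mathbb{G}$ be the category whose objects are graphs with finite chromatic number and whose morphisms are graph homomorphisms. $\overline{G}$ is the complement of $G$ (same vertex set, complementary edge set). The join $G*H$ has vertex set the disjoint union of $V(G)$ and $V(H)$, and its edges are all edges of $G$ and $H$ together with all pairs $xy$ with $x\in V(G)$, $y\in V(H)$. A sandwich function is a function $\Psi$ from objects of $\mathbb{G}$ to nonnegative real numbers such that: (1) $\Psi(\emptyset)=0$ for the empty graph, and $\Psi(G)=1$ if $G$ consists of a single vertex; (2) if there is a morphism $G\to G'$ in $\mathbb{G}$, then $\Psi(G)\le\Psi(G')$; (3) $\Psi(G*G')=\Psi(G)+\Psi(G')$ for all $G,G'$. For a finite nonempty graph $G$, consider real (symmetric) positive semidefinite $V(G)\times V(G)$ matrices $M$ with trace $1$. Then - $\vartheta^+(G)$ is the maximum of $\sum_{i,j}M_{ij}$ over such $M$ with $M_{ij}\le0$ for $ij\in E(G)$; - $\vartheta(G)$ is the maximum of $\sum_{i,j}M_{ij}$ over such $M$ with $M_{ij}=0$ for $ij\in E(G)$; - $\vartheta'(G)$ is the maximum of $\sum_{i,j}M_{ij}$ over such $M$ with $M_{ij}=0$ for $ij\in E(G)$ and $M_{ij}\ge0$ for all $i,j$. All three are $0$ for the empty graph. For $G$ infinite, $\vartheta(G)=\sup_{H\subseteq G}\vartheta(H)$, where $H$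 ranges over all induced finite subgraphs of $G$, and similarly for $\vartheta'$ and $\vartheta^+$. *)

(* Defs.v *)
From HB Require Import structures.
From mathcomp Require Import all_boot all_order all_algebra finmap ring lra.
From mathcomp Require Import all_classical all_reals all_analysis.
Set Implicit Arguments.
Unset Strict Implicit.
Unset Printing Implicit Defensive.
Import Order.TTheory GRing.Theory Num.Theory.
Import numFieldNormedType.Exports.
Local Open Scope classical_set_scope.
Local Open Scope ring_scope.

(* Classically every type is a choiceType and every binary predicate is
   boolean, so this covers all loopless undirected graphs. *)
Record graph := Graph {
  vertex :> choiceType;
  adj : rel vertex;
  adj_sym : symmetric adj;
  adj_irrefl : irreflexive adj }.

Arguments adj {g}.

Definition hom (G H : graph) : Prop :=
  exists f : G -> H, {homo f : x y / adj x y}.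

Definition finite_chromatic (G : graph) : Prop :=
  exists (k : nat) (c : G -> 'I_k), forall x y : G, adj x y -> c x != c y.

Section Complement.
Variable G : graph.

Definition compl_adj : rel G := [rel x y | (x != y) && ~~ adj x y].

Fact compl_adj_sym : symmetric compl_adj.
Proof. by move=> x y; rewrite /compl_adj /= (eq_sym x) (adj_sym x). Qed.

Fact compl_adj_irrefl : irreflexive compl_adj.
Proof. by move=> x; rewrite /compl_adj /= eqxx. Qed.

Definition compl : graph := Graph compl_adj_sym compl_adj_irrefl.

End Complement.

Section Join.
Variables G H : graph.

Definition join_adj : rel (G + H)%type := fun u v =>
  match u, v with
  | inl x, inl y => adj x y
  | inr x, inr y => adj x y
  | _, _ => true
  end.

Fact join_adj_sym : symmetric join_adj.
Proof. by case=> x [] y //=; exact: adj_sym. Qed.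

Fact join_adj_irrefl : irreflexive join_adj.
Proof. by case=> x /=; rewrite adj_irrefl. Qed.

Definition join : graph := Graph join_adj_sym join_adj_irrefl.

Lemma join_finite_chromatic :
  finite_chromatic G -> finite_chromatic H -> finite_chromatic join.
Proof.
move=> [k [c hc]] [l [d hd]]; exists (k + l)%N.
exists (fun u => match u with inl x => lshift l (c x) | inr y => rshift k (d y) end).
case=> x [] y /= xy; first by rewrite (inj_eq (@lshift_inj _ _)) hc.
- by rewrite eq_lrshift.
- by rewrite eq_rlshift.
- by rewrite (inj_eq (@rshift_inj _ _)) hd.
Qed.

End Join.

Record fc_graph := FCGraph {
  fc_val :> graph;
  fc_valP : finite_chromatic fc_val }.

Definition fc_join (G H : fc_graph) : fc_graph :=
  FCGraph (join_finite_chromatic (fc_valP G) (fc_valP H)).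

(* Psi takes values in \bar R because theta of an infinite graph is a supremum
   that may be infinite in general; sandwich_fin says that Psi is a function
   to the nonnegative real numbers. *)
Record is_sandwich (R : realType) (Psi : fc_graph -> \bar R) : Prop := {
  sandwich_fin : forall G, (0 <= Psi G < +oo)%E;
  sandwich_empty : forall G : fc_graph, (G -> False) -> Psi G = 0%E;
  sandwich_point : forall G : fc_graph,
    (exists x : G, forall y : G, y = x) -> Psi G = 1%E;
  sandwich_hom : forall G H : fc_graph, hom G H -> (Psi G <= Psi H)%E;
  sandwich_join : forall G H : fc_graph, Psi (fc_join G H) = (Psi G + Psi H)%E }.

Section Theta.
Variable R : realType.

Definition psd n (M : 'M[R]_n) : Prop :=
  M^T = M /\ forall v : 'rV[R]_n, 0 <= (v *m M *m v^T) 0 0.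

Definition entry_sum n (M : 'M[R]_n) : R := \sum_i \sum_j M i j.

Definition psd_tr1 n : set 'M[R]_n := [set M | psd M /\ \tr M = 1].

(* The supremum is attained whenever n > 0 in all the cases below: see
   theta_plus_fin_max, theta_fin_max and theta_prime_fin_max. For
   n = 0 the set is empty (the trace is 0), and sup set0 = 0. *)
Definition max_entry_sum n (C : set 'M[R]_n) : R :=
  sup [set entry_sum M | M in @psd_tr1 n `&` C].

(* A matrix indexed by T is a matrix over 'I_#|T|, via the bijection
   enum_val : 'I_#|T| -> T. *)
Definition theta_plus_cstr (T : finType) (e : rel T) : set 'M[R]_#|T| :=
  [set M | forall i j, e (enum_val i) (enum_val j) -> M i j <= 0].

Definition theta_cstr (T : finType) (e : rel T) : set 'M[R]_#|T| :=
  [set M | forall i j, e (enum_val i) (enum_val j) -> M i j = 0].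

Definition theta_prime_cstr (T : finType) (e : rel T) : set 'M[R]_#|T| :=
  [set M | (forall i j, e (enum_val i) (enum_val j) -> M i j = 0) /\
           (forall i j, 0 <= M i j)].

Definition theta_plus_fin (T : finType) (e : rel T) : R :=
  max_entry_sum (theta_plus_cstr e).
Definition theta_fin (T : finType) (e : rel T) : R :=
  max_entry_sum (theta_cstr e).
Definition theta_prime_fin (T : finType) (e : rel T) : R :=
  max_entry_sum (theta_prime_cstr e).

Definition induced_adj (G : graph) (A : {fset G}) : rel A :=
  fun x y => adj (val x) (val y).

(* A graph whose carrier is a finite set is treated as the induced subgraph on
   all its vertices, which provides the finType structure. *)
Definition extend_theta (f : forall T : finType, rel T -> R) (G : graph)
    : \bar R :=
  if `[< finite_set [set: G] >]
  then (f _ (induced_adj (A := fset_set [set: G])))%:E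
  else ereal_sup [set (f _ (induced_adj (A := A)))%:E | A in [set: {fset G}]].

Definition theta_plus : graph -> \bar R := extend_theta theta_plus_fin.
Definition theta : graph -> \bar R := extend_theta theta_fin.
Definition theta_prime : graph -> \bar R := extend_theta theta_prime_fin.

End Theta.

Section Attained.
Variable R : realType.

Definition is_max (S : set R) (x : R) : Prop :=
  S x /\ forall y, S y -> y <= x.

Lemma is_max_sup (S : set R) x : is_max S x -> is_max S (sup S).
Proof.
move=> [Sx xS]; suff -> : sup S = x by split.
apply/eqP; rewrite eq_le; apply/andP; split.
  by apply: ge_sup; first by exists x.
by apply: ub_le_sup => //; exists x => y; exact: xS.
Qed.

Lemma psd_diag n (M : 'M[R]_n) i : psd M -> 0 <= M i i.
Proof.
move=> [_ /(_ (delta_mx 0 i))].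
by rewrite -rowE trmx_delta -colE !mxE.
Qed.

Lemma psd_entry n (M : 'M[R]_n) i j : psd M -> `|M i j| *+ 2 <= M i i + M j j.
Proof.
move=> psdM; have [sM qM] := psdM.
have Mji : M j i = M i j by rewrite -{1}sM mxE.
have H (s : R) : s * s = 1 -> 0 <= M i i + M j j + (s * M i j) *+ 2.
  move=> ss; have := qM (delta_mx 0 i + s *: delta_mx 0 j).
  rewrite mulmxDl -scalemxAl -!rowE linearD linearZ /= !trmx_delta.
  rewrite mulmxDr -scalemxAr -!colE !mxE Mji; congr (0 <= _).
  by rewrite mulrDr mulrA ss; ring.
have := H 1 (mulr1 _); have := H (-1) ltac:(by rewrite mulrNN mulr1).
by case: (ger0P (M i j)) => _; lra.
Qed.

Lemma psd_tr1_entry n (M : 'M[R]_n) i j : psd_tr1 M -> `|M i j| <= 1.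
Proof.
move=> [psdM trM].
have Mle k : M k k <= 1.
  rewrite -trM /mxtrace (bigD1 k) //= lerDl.
  by apply: sumr_ge0 => l _; exact: psd_diag.
rewrite -(ler_pMn2r (ltn0Sn 1)); apply: le_trans (psd_entry i j psdM) _.
by rewrite mulr2n lerD.
Qed.

Lemma continuous_vec_mx_entry n i j :
  continuous (fun v : 'rV[R]_(n * n) => (vec_mx v : 'M[R]_n) i j).
Proof.
have -> : (fun v : 'rV[R]_(n * n) => (vec_mx v : 'M[R]_n) i j) =
          (fun v => v 0 (mxvec_index i j)).
  by apply/funext => v; rewrite mxE.
exact: coord_continuous.
Qed.

Lemma continuous_bigsum (T : topologicalType) (I : Type) (r : seq I)
    (F : I -> T -> R) :
  (forall i, continuous (F i)) -> continuous (fun x => \sum_(i <- r) F i x).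
Proof.
move=> cF x; elim: r => [|i r IH].
  rewrite (_ : (fun _ => _) = cst 0); last by apply/funext => y; rewrite big_nil.
  exact: cvg_cst.
rewrite (_ : (fun _ => _) = (fun y => F i y + \sum_(j <- r) F j y)).
  by apply: cvgD; [exact: cF|exact: IH].
by apply/funext => y; rewrite big_cons.
Qed.

Lemma closed_preim (T : topologicalType) (f : T -> R) (S : set R) :
  continuous f -> closed S -> closed (f @^-1` S).
Proof. by move=> cf; apply: closed_comp => x _; exact: cf. Qed.

Lemma closed_forall (T : topologicalType) (I : Type) (P : I -> T -> Prop) :
  (forall i, closed [set x | P i x]) -> closed [set x | forall i, P i x].
Proof.
move=> cP; rewrite (_ : mkset _ = \bigcap_(i in setT) [set x | P i x]).
  by apply: closed_bigI => i _; exact: cP.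
by apply/seteqP; split=> x /= h i; [move=> _|]; apply: h.
Qed.

Lemma closed_imply (T : topologicalType) (b : Prop) (P : T -> Prop) :
  closed [set x | P x] -> closed [set x | b -> P x].
Proof. by move=> cP; apply: closed_forall. Qed.

Lemma max_entry_sum_max n (C : set 'M[R]_n) :
  @psd_tr1 R n `&` C !=set0 -> closed [set v : 'rV[R]_(n * n) | C (vec_mx v)] ->
  is_max [set entry_sum M | M in @psd_tr1 R n `&` C] (max_entry_sum C).
Proof.
move=> [M0 CM0] clC.
pose A := [set v : 'rV[R]_(n * n) | (@psd_tr1 R n `&` C) (vec_mx v)].
have cE := @continuous_vec_mx_entry n.
have A0 : A !=set0 by exists (mxvec M0); rewrite /A /= mxvecK.
have clA : closed A.
  rewrite (_ : A = ([set v | (vec_mx v : 'M[R]_n)^T = vec_mx v] `&`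
    [set v | forall u : 'rV_n, 0 <= (u *m vec_mx v *m u^T) 0 0]) `&`
    [set v | \tr (vec_mx v : 'M[R]_n) = 1] `&` [set v | C (vec_mx v)]).
    apply: closedI => //; apply: closedI; first apply: closedI.
    - rewrite (_ : mkset _ = [set v | forall i j,
          (vec_mx v : 'M[R]_n) j i - (vec_mx v : 'M[R]_n) i j = 0]).
        apply: closed_forall => i; apply: closed_forall => j.
        apply: (closed_preim (S := [set x | x = 0])); last exact: closed_eq.
        by move=> v; exact: (cvgB (cE j i v) (cE i j v)).
      apply/seteqP; split=> v /= h.
        by move=> i j; move/matrixP: h => /(_ i j); rewrite mxE => ->; rewrite subrr.
      by apply/matrixP => i j; rewrite mxE; apply/eqP; rewrite -subr_eq0 h.
    - apply: closed_forall => u.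
      apply: (closed_preim (S := [set x | 0 <= x])); last exact: closed_ge.
      rewrite (_ : (fun _ => _) = (fun v => \sum_j (\sum_i u 0 i * (vec_mx v : 'M[R]_n) i j) * u 0 j)).
        apply: continuous_bigsum => j.
        have cj : continuous (fun v => \sum_i u 0 i * (vec_mx v : 'M[R]_n) i j).
          apply: continuous_bigsum => i w.
          exact: (@cvgMl_tmp _ _ _ _ _ (u 0 i) _ (cE i j w)).
        move=> w; exact: (@cvgMr_tmp _ _ _ _ _ _ (u 0 j) (cj w)).
      by apply/funext => v; rewrite mxE; apply: eq_bigr => j _; rewrite !mxE.
    - apply: (closed_preim (S := [set x | x = 1])); last exact: closed_eq.
      by apply: continuous_bigsum => i; exact: cE.
  by apply/seteqP; split=> v; rewrite /A /= /psd_tr1 /psd /=; tauto.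
have bA : bounded_set A.
  exists 1; split=> // b b1 v [/= pv _].
  rewrite [leLHS]/Num.norm /= mx_normrE; apply/bigmax_leP; split=> /=.
    by apply: le_trans (ltW b1).
  move=> [i k] _ /=; rewrite ord1 -(vec_mxK v).
  case/mxvec_indexP: k => p q; rewrite mxvecE.
  by apply: le_trans (ltW b1); exact: psd_tr1_entry.
have cf : continuous (fun v : 'rV[R]_(n * n) => entry_sum (vec_mx v : 'M[R]_n)).
  apply: (continuous_bigsum (F := fun i v => \sum_j (vec_mx v : 'M[R]_n) i j)) => i.
  exact: continuous_bigsum.
have [v Av vmax] := EVT_max_rV A0 (bounded_closed_compact bA clA)
  (continuous_subspaceT cf).
apply: (@is_max_sup _ (entry_sum (vec_mx v : 'M[R]_n))); split.
  by exists (vec_mx v) => //; move: Av; rewrite inE.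
move=> _ [M CM <-]; rewrite -[M]mxvecK; apply: vmax.
by rewrite inE /A /= mxvecK.
Qed.

Lemma psd_tr1_delta n (i : 'I_n) : psd_tr1 (delta_mx i i : 'M[R]_n).
Proof.
split; first (split; first exact: trmx_delta).
  move=> v; rewrite -(mul_delta_mx (0 : 'I_1)) mulmxA -colE -mulmxA -rowE.
  by rewrite mxE big_ord1 !mxE -expr2 sqr_ge0.
rewrite /mxtrace (bigD1 i) //= big1 => [|j ji]; rewrite !mxE ?eqxx ?addr0 //.
by rewrite (negPf ji).
Qed.

Section Cases.
Variables (T : finType) (e : rel T).
Hypotheses (T0 : (0 < #|T|)%N) (e_irr : irreflexive e).

Let delta_edge (i j k : 'I_#|T|) :
  e (enum_val i) (enum_val j) -> (delta_mx k k : 'M[R]_#|T|) i j = 0.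
Proof.
by rewrite mxE; case: eqVneq => // ->; case: eqVneq => // ->; rewrite e_irr.
Qed.

Let closed_entry (S : set R) i j : closed S ->
  closed [set v : 'rV[R]_(#|T| * #|T|) | S ((vec_mx v : 'M[R]_#|T|) i j)].
Proof. by apply: closed_preim; exact: continuous_vec_mx_entry. Qed.

Lemma theta_plus_fin_max :
  is_max [set entry_sum M | M in @psd_tr1 R #|T| `&` theta_plus_cstr e]
         (theta_plus_fin R e).
Proof.
apply: max_entry_sum_max.
  exists (delta_mx (Ordinal T0) (Ordinal T0)); split; first exact: psd_tr1_delta.
  by move=> i j eij; rewrite delta_edge.
apply: closed_forall => i; apply: closed_forall => j; apply: closed_imply.
by apply: (closed_entry (S := [set x | x <= 0])); exact: closed_le.
Qed.

Lemma theta_fin_max :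
  is_max [set entry_sum M | M in @psd_tr1 R #|T| `&` theta_cstr e]
         (theta_fin R e).
Proof.
apply: max_entry_sum_max.
  exists (delta_mx (Ordinal T0) (Ordinal T0)); split; first exact: psd_tr1_delta.
  by move=> i j eij; rewrite delta_edge.
apply: closed_forall => i; apply: closed_forall => j; apply: closed_imply.
by apply: (closed_entry (S := [set x | x = 0])); exact: closed_eq.
Qed.

Lemma theta_prime_fin_max :
  is_max [set entry_sum M | M in @psd_tr1 R #|T| `&` theta_prime_cstr e]
         (theta_prime_fin R e).
Proof.
apply: max_entry_sum_max.
  exists (delta_mx (Ordinal T0) (Ordinal T0)); split; first exact: psd_tr1_delta.
  split=> i j; first by move=> eij; rewrite delta_edge.
  by rewrite mxE ler0n.
apply: closedI; apply: closed_forall => i; apply: closed_forall => j.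
  apply: closed_imply.
  by apply: (closed_entry (S := [set x | x = 0])); exact: closed_eq.
by apply: (closed_entry (S := [set x | 0 <= x])); exact: closed_ge.
Qed.

End Cases.
End Attained.

(* Main.v *)
Require Import Defs.
From mathcomp Require Import all_boot all_order all_algebra.
From mathcomp Require Import finmap ring lra.
From mathcomp Require Import all_classical all_reals all_analysis.
Set Implicit Arguments.
Unset Strict Implicit.
Unset Printing Implicit Defensive.
Import Order.TTheory GRing.Theory Num.Theory.
Local Open Scope classical_set_scope.
Local Open Scope ring_scope.

(* The three parameters differ only in which values an entry of M may take on
   an edge or on the diagonal, and which on a non-edge of G; for all three
   these values form cones (edge_val is even a semiring, and nonedge_val
   contains no positive number), and nothing else is used.

   Matrices are indexed by arbitrary finite families of vertices, repetitions
   allowed, so that homomorphisms act by composition.  Summing the entries over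
   the fibres of the family turns such a matrix into one indexed by vertices:
   it keeps the total and does not increase the trace, since vertices with the
   same image are not adjacent.  Pushing forward along a k-coloring bounds the
   value by k.

   For the join, write a matrix as blocks with quadratic form values s, w, t on
   the indicator vectors of the two sides.  By Cauchy-Schwarz w^2 <= s t, hence
   s + 2 w + t <= (a + b)(p + q) whenever s <= a p and t <= b q.  Conversely,
   for A, B of trace 1 and totals a, b, the matrix
   [[a A, (A 1)(B 1)^T], [(B 1)(A 1)^T, b B]] is positive semidefinite, again by
   Cauchy-Schwarz, and has total (a + b)^2 and trace a + b. *)

(** * Positive semidefinite kernels on a finite index set *)

Section BilinearForm.
Variables (R : realType) (T : finType).
Implicit Types (M : T -> T -> R) (x y : T -> R).

Definition bform M x y := \sum_i \sum_j x i * M i j * y j.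
Definition psd_form M :=
  (forall i j, M i j = M j i) /\ forall x, 0 <= bform M x x.
Definition total M := \sum_i \sum_j M i j.
Definition trace M := \sum_i M i i.

Lemma eq_bform M x x' y y' :
  x =1 x' -> y =1 y' -> bform M x y = bform M x' y'.
Proof.
by move=> xx yy; apply: eq_bigr => i _; apply: eq_bigr => j _; rewrite xx yy.
Qed.

Lemma bformDl M x x' y :
  bform M (fun i => x i + x' i) y = bform M x y + bform M x' y.
Proof.
rewrite -big_split; apply: eq_bigr => i _ /=.
by rewrite -big_split; apply: eq_bigr => j _ /=; ring.
Qed.

Lemma bformZl M a x y : bform M (fun i => a * x i) y = a * bform M x y.
Proof.
rewrite mulr_sumr; apply: eq_bigr => i _.
by rewrite mulr_sumr; apply: eq_bigr => j _ /=; ring.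
Qed.

Lemma bformC M x y : (forall i j, M i j = M j i) -> bform M x y = bform M y x.
Proof.
move=> sM; rewrite /bform exchange_big; apply: eq_bigr => i _.
by apply: eq_bigr => j _; rewrite sM; ring.
Qed.

Lemma bform_total M : bform M (fun=> 1) (fun=> 1) = total M.
Proof.
by apply: eq_bigr => i _; apply: eq_bigr => j _; rewrite mul1r mulr1.
Qed.

Lemma bform_delta M i j :
  bform M (fun k => (k == i)%:R) (fun k => (k == j)%:R) = M i j.
Proof.
rewrite /bform (bigD1 i) //= [X in _ + X]big1 ?addr0 => [|k /negPf ki].
  rewrite (bigD1 j) //= big1 ?addr0 => [|k /negPf kj].
    by rewrite !eqxx mul1r mulr1.
  by rewrite kj mulr0.
by rewrite big1 // => l _; rewrite ki !mul0r.
Qed.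

Lemma psd_bformDZ M a b x y : psd_form M ->
  bform M (fun i => a * x i + b * y i) (fun i => a * x i + b * y i) =
  a ^+ 2 * bform M x x + (a * b * bform M x y) *+ 2 + b ^+ 2 * bform M y y.
Proof.
move=> [sM _]; rewrite bformDl !bformZl.
rewrite !(bformC _ (fun i => a * x i + b * y i) sM).
by rewrite !bformDl !bformZl (bformC y x sM); ring.
Qed.

Lemma psd_CauchySchwarz M x y : psd_form M ->
  bform M x y ^+ 2 <= bform M x x * bform M y y.
Proof.
move=> psdM; have [_ qM] := psdM; set a := bform M x x; set b := bform M x y; set c := bform M y y.
have H s t : 0 <= s ^+ 2 * a + (s * t * b) *+ 2 + t ^+ 2 * c.
  by rewrite -psd_bformDZ //; exact: qM.
have a0 : 0 <= a by exact: qM.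
have c0 : 0 <= c by exact: qM.
have [cp|cp] := ltP 0 c.
  (* The vector [c x - b y] is orthogonal to [y] for the form; its value is [c] times the
     discriminant. *)
  have := H c (- b).
  have -> : c ^+ 2 * a + (c * - b * b) *+ 2 + (- b) ^+ 2 * c =
            c * (a * c - b ^+ 2) by ring.
  by rewrite pmulr_rge0 // subr_ge0.
have {c0 cp}cE : c = 0 by apply/eqP; rewrite eq_le cp c0.
(* With [c = 0] the form is linear in [t]; this choice of [t] makes it exactly [- b ^+ 2], forcing
   [b = 0]. *)
have := H (b) (- (a + 1) / 2); rewrite cE !mulr0 addr0.
have -> : b ^+ 2 * a + (b * (- (a + 1) / 2) * b) *+ 2 = - b ^+ 2 by field.
by rewrite oppr_ge0.
Qed.

(** The form is nonnegative at the difference of the two unit vectors. *)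
Lemma psd_form_entry M i j : psd_form M -> M i j *+ 2 <= M i i + M j j.
Proof.
move=> psdM; have := psd_bformDZ 1 (-1) (fun k => (k == i)%:R)
  (fun k => (k == j)%:R) psdM.
rewrite !bform_delta => E; rewrite -subr_ge0.
have -> : M i i + M j j - M i j *+ 2 =
  1 ^+ 2 * M i i + (1 * -1 * M i j) *+ 2 + (-1) ^+ 2 * M j j by ring.
by rewrite -E; case: psdM => _; apply.
Qed.

Lemma psd_form_diag M i : psd_form M -> 0 <= M i i.
Proof. by move=> [_ qM]; rewrite -bform_delta. Qed.

Lemma psd_trace_ge0 M : psd_form M -> 0 <= trace M.
Proof. by move=> psdM; apply: sumr_ge0 => i _; exact: psd_form_diag. Qed.

Lemma psd_total_ge0 M : psd_form M -> 0 <= total M.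
Proof. by move=> [_ qM]; rewrite -bform_total. Qed.

Lemma psd_total_le M : psd_form M -> total M <= #|T|%:R * trace M.
Proof.
move=> psdM; rewrite -(ler_pMn2r (ltn0Sn 1)).
apply: (@le_trans _ _ (\sum_i \sum_j (M i i + M j j))).
  rewrite -sumrMnl; apply: ler_sum => i _; rewrite -sumrMnl.
  by apply: ler_sum => j _; exact: psd_form_entry.
under eq_bigr => i _ do rewrite big_split /= sumr_const.
by rewrite big_split /= sumr_const sumrMnl -mulr2n mulr_natl.
Qed.

Lemma psd_scale M a : 0 <= a -> psd_form M -> psd_form (fun i j => a * M i j).
Proof.
move=> a0 [sM qM]; split=> [i j|x]; first by rewrite sM.
suff -> : bform (fun i j => a * M i j) x x = a * bform M x x by rewrite mulr_ge0.
rewrite mulr_sumr; apply: eq_bigr => i _.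
by rewrite mulr_sumr; apply: eq_bigr => j _; ring.
Qed.

Lemma totalZ M a : total (fun i j => a * M i j) = a * total M.
Proof. by rewrite mulr_sumr; apply: eq_bigr => i _; rewrite mulr_sumr. Qed.

Lemma traceZ M a : trace (fun i j => a * M i j) = a * trace M.
Proof. by rewrite mulr_sumr. Qed.

Lemma bform_mask M z x y : bform (fun i j => z i * M i j * z j) x y =
  bform M (fun i => z i * x i) (fun i => z i * y i).
Proof. by apply: eq_bigr => i _; apply: eq_bigr => j _; ring. Qed.

Lemma psd_mask M z : psd_form M -> psd_form (fun i j => z i * M i j * z j).
Proof.
move=> [sM qM]; split=> [i j|x]; last by rewrite bform_mask.
by rewrite sM; ring.
Qed.

End BilinearForm.

(** * Pushing kernels forward along a map of index sets *)

Section Push.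
Variables (R : realType) (T U : finType) (h : T -> U).
Implicit Types M : T -> T -> R.

Definition push M (u v : U) := \sum_(i | h i == u) \sum_(j | h j == v) M i j.

(** Change of variables: [F] is taken to be a product for semidefiniteness, constant for the total,
    and the diagonal indicator for the trace. *)
Lemma sum_push M (F : U -> U -> R) : \sum_u \sum_v F u v * push M u v =
  \sum_i \sum_j F (h i) (h j) * M i j.
Proof.
rewrite [RHS](partition_big h predT) //=; apply: eq_bigr => u _.
under eq_bigr => v _ do rewrite mulr_sumr.
rewrite exchange_big; apply: eq_bigr => i /eqP <-.
rewrite [RHS](partition_big h predT) //=; apply: eq_bigr => v _.
by rewrite mulr_sumr; apply: eq_bigr => j /eqP <-.
Qed.

Lemma psd_push M : psd_form M -> psd_form (push M).
Proof.
move=> [sM qM]; split=> [u v|x].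
  rewrite /push exchange_big; apply: eq_bigr => i _; apply: eq_bigr => j _.
  exact: sM.
rewrite (_ : bform _ _ _ = bform M (x \o h) (x \o h)) //.
transitivity (\sum_u \sum_v (x u * x v) * push M u v).
  by apply: eq_bigr => u _; apply: eq_bigr => v _; ring.
by rewrite sum_push; apply: eq_bigr => u _; apply: eq_bigr => v _ /=; ring.
Qed.

Lemma total_push M : total (push M) = total M.
Proof.
transitivity (\sum_u \sum_v 1 * push M u v).
  by apply: eq_bigr => u _; apply: eq_bigr => v _; rewrite mul1r.
rewrite (sum_push M (fun _ _ => 1)).
by apply: eq_bigr => i _; apply: eq_bigr => j _; rewrite mul1r.
Qed.

Lemma trace_push M : trace (push M) = \sum_i \sum_(j | h i == h j) M i j.
Proof.
transitivity (\sum_u \sum_v (u == v)%:R * push M u v).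
  apply: eq_bigr => u _; rewrite (bigD1 u) //= eqxx mul1r big1 ?addr0 // => v.
  by rewrite eq_sym => /negPf ->; rewrite mul0r.
rewrite sum_push; apply: eq_bigr => i _; rewrite [RHS]big_mkcond /=.
by apply: eq_bigr => j _; case: eqP; rewrite ?mul1r ?mul0r.
Qed.

End Push.

(* [edge_val] also governs the diagonal entries. *)
Record entry_cone (R : realType) := EntryCone {
  edge_val : R -> Prop;
  nonedge_val : R -> Prop;
  edge_ge0 : forall x, 0 <= x -> edge_val x;
  edgeD : forall x y, edge_val x -> edge_val y -> edge_val (x + y);
  edgeM : forall x y, edge_val x -> edge_val y -> edge_val (x * y);
  nonedge0 : nonedge_val 0;
  nonedgeD : forall x y, nonedge_val x -> nonedge_val y -> nonedge_val (x + y);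
  nonedgeZ : forall a x, 0 <= a -> nonedge_val x -> nonedge_val (a * x);
  nonedge_le0 : forall x, nonedge_val x -> x <= 0 }.

(** * Feasible kernels and bounds on their totals *)

Section Feasible.
Variables (R : realType) (K : entry_cone R).

(* [f] need not be injective: a repeated vertex is a pair of non-adjacent
   indices, so that [M] is constrained by the pullback of [G] along [f]. *)
Definition feasible (G : graph) (T : finType) (f : T -> G) (M : T -> T -> R) :=
  [/\ psd_form M, forall i j, edge_val K (M i j) &
      forall i j, i != j -> ~~ adj (f i) (f j) -> nonedge_val K (M i j)].

(** An upper bound for the homogenized program, without normalizing the trace. The clause [0 <= c]
    makes 0 the least bound for the empty graph, where all totals and traces vanish. *)
Definition theta_bound (G : graph) (c : R) := 0 <= c /\
  forall (T : finType) (f : T -> G) M, feasible f M -> total M <= c * trace M.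

Lemma edge_sum (I : finType) (P : pred I) (F : I -> R) :
  (forall i, P i -> edge_val K (F i)) -> edge_val K (\sum_(i | P i) F i).
Proof.
move=> PF; elim/big_rec: _ => [|i x Pi Kx]; first exact: edge_ge0.
by apply: edgeD => //; exact: PF.
Qed.

Lemma nonedge_sum (I : finType) (P : pred I) (F : I -> R) :
  (forall i, P i -> nonedge_val K (F i)) -> nonedge_val K (\sum_(i | P i) F i).
Proof.
move=> PF; elim/big_rec: _ => [|i x Pi Kx]; first exact: nonedge0.
by apply: nonedgeD => //; exact: PF.
Qed.

Lemma feasible_scale (G : graph) (T : finType) (f : T -> G) M a : 0 <= a ->
  feasible f M -> feasible f (fun i j => a * M i j).
Proof.
move=> a0 [psdM eM nM]; split=> [|i j|i j ij fij]; first exact: psd_scale.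
  by apply: edgeM => //; exact: edge_ge0.
by apply: nonedgeZ => //; exact: nM.
Qed.

Section FeasiblePush.
Variables (G H : graph) (T U : finType) (f : T -> G) (g : U -> H) (h : T -> U).
Hypothesis hfg : forall i j, adj (f i) (f j) -> adj (g (h i)) (g (h j)).
Variable M : T -> T -> R.
Hypothesis feasM : feasible f M.

Lemma feasible_push : feasible g (push h M).
Proof.
case: feasM => psdM eM nM; split=> [|u v|u v uv guv]; first exact: psd_push.
  by apply: edge_sum => i _; apply: edge_sum => j _.
apply: nonedge_sum => i /eqP hi; apply: nonedge_sum => j /eqP hj.
apply: nM; first by apply: contraNneq uv => ij; rewrite -hi -hj ij.
by apply: contraNN guv => /hfg; rewrite hi hj.
Qed.

Lemma trace_push_le : trace (push h M) <= trace M.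
Proof.
rewrite trace_push; apply: ler_sum => i _.
(* Beyond the diagonal, the fibre sums only contain pairs with equal image; [H] is loopless, so
   these are non-adjacent and their entries are at most 0. *)
rewrite (bigD1 i) //= gerDl; apply: sumr_le0 => j /andP[/eqP hij ji].
case: feasM => _ _ nM; apply: (nonedge_le0 (nM i j _ _)); first by rewrite eq_sym.
by apply/negP => /hfg; rewrite hij adj_irrefl.
Qed.

End FeasiblePush.

Lemma theta_bound_hom (G H : graph) c :
  Defs.hom G H -> theta_bound H c -> theta_bound G c.
Proof.
move=> [h hP] [c0 bH]; split=> // T f M [psdM eM nM]; apply: (bH T (h \o f)).
by split=> // i j ij; move/(contraNN (@hP _ _)); exact: nM.
Qed.

Lemma theta_bound_coloring (G : graph) k (c : G -> 'I_k) :
  (forall x y, adj x y -> c x != c y) -> theta_bound G k%:R.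
Proof.
move=> cP; split=> [|T f M feasM]; first exact: ler0n.
(* The target is the complete graph on the [k] colors, indexed by its own vertices. *)
have sym : symmetric [rel u v : 'I_k | u != v] by move=> u v; rewrite /= eq_sym.
have irr : irreflexive [rel u v : 'I_k | u != v] by move=> u; rewrite /= eqxx.
pose Kk := Graph sym irr.
have hP i j : adj (f i) (f j) -> @adj Kk (c (f i)) (c (f j)) by exact: cP.
have [psdN _ _] := @feasible_push G Kk T 'I_k f id (c \o f) hP M feasM.
rewrite -(total_push (c \o f)); apply: le_trans (psd_total_le psdN) _.
rewrite card_ord ler_wpM2l // ?ler0n //.
exact: (@trace_push_le G Kk T 'I_k f id (c \o f) hP M feasM).
Qed.


(** * Upper bounds for joins *)

Lemma total_le_mask (G H : graph) (T : finType) (f : T -> H) (g : T -> G)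
    (P : pred T) M c :
  feasible f M -> (forall i j, P i -> P j -> adj (f i) (f j) -> adj (g i) (g j)) ->
  theta_bound G c ->
  bform M (fun i => (P i)%:R) (fun i => (P i)%:R) <=
  c * \sum_i (P i)%:R * M i i.
Proof.
move=> [psdM eM nM] gP [_ /(_ T g)].
(* Entries outside [P] are zeroed rather than removed. Since 0 is both an edge and a non-edge value,
   [g] may be arbitrary off [P]. *)
move=> /(_ (fun i j => (P i)%:R * M i j * (P j)%:R)).
rewrite -bform_total bform_mask.
rewrite (@eq_bform _ _ _ _ (fun i => (P i)%:R) _ (fun i => (P i)%:R));
  try by move=> i; rewrite mulr1.
rewrite (_ : trace _ = \sum_i (P i)%:R * M i i); last first.
  by apply: eq_bigr => i _; case: (P i); rewrite ?mul1r ?mulr1 ?mul0r.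
apply; split=> [|i j|i j ij]; first exact: psd_mask.
  case: (P i) (P j) => [] []; rewrite ?(mul0r, mulr0, mul1r, mulr1) //;
    exact: edge_ge0.
case Pi: (P i); case Pj: (P j);
  rewrite ?(mul0r, mulr0, mul1r, mulr1) => nij; do ?exact: nonedge0.
by apply: nM => //; apply: contraNN nij; exact: gP.
Qed.

Lemma theta_bound_le (G : graph) a b :
  a <= b -> theta_bound G a -> theta_bound G b.
Proof.
move=> ab [a0 Ga]; split=> [|T f M fM]; first exact: le_trans ab.
apply: le_trans (Ga _ _ _ fM) _; rewrite ler_wpM2r //.
by case: fM => psdM _ _; exact: psd_trace_ge0.
Qed.

Lemma theta_bound_join (G H : graph) a b :
  theta_bound G a -> theta_bound H b -> theta_bound (join G H) (a + b).
Proof.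
move=> Ga Hb; have [a0 _] := Ga; have [b0 _] := Hb.
(* If one side is empty, the join maps to the other side. Otherwise [x0] and [y0] serve as dummy
   images for indices on the wrong side. *)
have [[x0]|G0] := pselect (inhabited G); last first.
  have F (x : G) : False by apply: G0; exact: (inhabits x).
  apply: (@theta_bound_hom _ H); last by apply: theta_bound_le Hb; rewrite lerDr.
  exists (fun u => match u with inl x => match F x with end | inr y => y end).
  by case=> [x|x] [y|y] //=; try case: (F x); try case: (F y).
have [[y0]|H0] := pselect (inhabited H); last first.
  have F (x : H) : False by apply: H0; exact: (inhabits x).
  apply: (@theta_bound_hom _ G); last by apply: theta_bound_le Ga; rewrite lerDl.
  exists (fun u => match u with inl x => x | inr y => match F y with end end).
  by case=> [x|x] [y|y] //=; try case: (F x); try case: (F y).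
split=> [|T f M fM]; first exact: addr_ge0.
pose P i := if f i is inl _ then true else false.
pose x i : R := (P i)%:R; pose y i : R := (~~ P i)%:R.
pose p := \sum_i x i * M i i; pose q := \sum_i y i * M i i.
have [psdM _ _] := fM.
have xxa : bform M x x <= a * p.
  apply: (@total_le_mask G (join G H) T f
    (fun i => if f i is inl z then z else x0) P M a fM _ Ga) => i j.
  by rewrite /P; case: (f i) => [?|?]; case: (f j).
have yyb : bform M y y <= b * q.
  apply: (@total_le_mask H (join G H) T f
    (fun i => if f i is inr z then z else y0) (fun i => ~~ P i) M b fM _ Hb) => i j.
  by rewrite /P; case: (f i) => [?|?]; case: (f j).
have pq : trace M = p + q.
  rewrite -big_split; apply: eq_bigr => i _ /=.
  by rewrite /x /y; case: (P i); rewrite mul1r mul0r ?addr0 ?add0r.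
have p0 : 0 <= p.
  apply: sumr_ge0 => i _; apply: mulr_ge0; first exact: ler0n.
  exact: psd_form_diag.
have q0 : 0 <= q.
  apply: sumr_ge0 => i _; apply: mulr_ge0; first exact: ler0n.
  exact: psd_form_diag.
have tM : total M = bform M x x + bform M x y *+ 2 + bform M y y.
  have := psd_bformDZ 1 1 x y psdM; rewrite !expr1n !mul1r => <-.
  rewrite -bform_total; apply: eq_bform => i;
  by rewrite /x /y; case: (P i); rewrite !mul1r ?addr0 ?add0r.
have := psd_CauchySchwarz x y psdM.
have xx0 : 0 <= bform M x x by case: psdM => _; apply.
have yy0 : 0 <= bform M y y by case: psdM => _; apply.
rewrite tM pq; set s := bform M x x in xxa xx0 *; set t := bform M y y in yyb yy0 *.
set w := bform M x y => wst.
suff w2 : w *+ 2 <= a * q + b * p by lra.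
have ab0 : 0 <= a * q + b * p by rewrite addr_ge0 ?mulr_ge0.
have [w0|w0] := lerP w 0.
  by apply: le_trans ab0; rewrite mulrn_wle0.
rewrite -ler_sqr ?nnegrE ?mulrn_wge0 ?(ltW w0) //.
(* [4 w^2 <= 4 s t <= 4 (a q)(b p) <= (a q + b p)^2], the last step being AM-GM. *)
have : s * t <= (a * p) * (b * q) by rewrite ler_pM.
have := sqr_ge0 (a * q - b * p); nra.
Qed.

(* The matrix of the header, made homogeneous: for A and B of arbitrary traces,
   multiplied by (trace A)^2 (trace B)^2. *)
Definition join_kernel (T U : finType) (A : T -> T -> R) (B : U -> U -> R)
    (i j : T + U) : R :=
  match i, j with
  | inl i, inl j => total A * trace B ^+ 2 * A i j
  | inr i, inr j => total B * trace A ^+ 2 * B i j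
  | inl i, inr j => trace A * trace B * ((\sum_k A i k) * (\sum_k B j k))
  | inr i, inl j => trace A * trace B * ((\sum_k A j k) * (\sum_k B i k))
  end.

(** The mixed blocks have rank one, so their double sums factor through the row sums of [A] and
    [B]. *)
Lemma bform_join_kernel (T U : finType) (A : T -> T -> R) (B : U -> U -> R) z :
  bform (join_kernel A B) z z =
  total A * trace B ^+ 2 * bform A (z \o inl) (z \o inl) +
  (trace A * trace B * (bform A (z \o inl) (fun=> 1) *
                        bform B (z \o inr) (fun=> 1))) *+ 2 +
  total B * trace A ^+ 2 * bform B (z \o inr) (z \o inr).
Proof.
have rowE (V : finType) (C : V -> V -> R) x :
    bform C x (fun=> 1) = \sum_i x i * \sum_k C i k.
  apply: eq_bigr => i _; rewrite mulr_sumr.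
  by apply: eq_bigr => j _; rewrite mulr1.
rewrite !rowE.
rewrite [(\sum_i (z \o inl) i * _) * _]big_distrlr /=.
rewrite {1}/bform big_sumType /=.
under eq_bigr => i _ do rewrite big_sumType /=.
under [X in _ + X]eq_bigr => i _ do rewrite big_sumType /=.
rewrite !big_split /= mulr2n !addrA.
congr (_ + _ + _ + _).
- by rewrite [RHS]mulr_sumr; apply: eq_bigr => i _; rewrite [RHS]mulr_sumr;
    apply: eq_bigr => j _ /=; ring.
- by rewrite [RHS]mulr_sumr; apply: eq_bigr => i _; rewrite [RHS]mulr_sumr;
    apply: eq_bigr => j _ /=; ring.
- by rewrite exchange_big [RHS]mulr_sumr; apply: eq_bigr => i _; rewrite [RHS]mulr_sumr;
    apply: eq_bigr => j _ /=; ring.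
- by rewrite [RHS]mulr_sumr; apply: eq_bigr => i _; rewrite [RHS]mulr_sumr;
    apply: eq_bigr => j _ /=; ring.
Qed.

Lemma psd_join_kernel (T U : finType) (A : T -> T -> R) (B : U -> U -> R) :
  psd_form A -> psd_form B -> psd_form (join_kernel A B).
Proof.
move=> psdA psdB; split=> [[i|i] [j|j]|z] //=; first by case: psdA => ->.
  by case: psdB => ->.
rewrite bform_join_kernel.
have := psd_CauchySchwarz (z \o inl) (fun=> 1) psdA; rewrite bform_total.
have := psd_CauchySchwarz (z \o inr) (fun=> 1) psdB; rewrite bform_total.
set a := bform A _ (fun=> 1); set b := bform B _ (fun=> 1) => hB hA.
have := ler_wpM2l (sqr_ge0 (trace B)) hA.
have := ler_wpM2l (sqr_ge0 (trace A)) hB.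
(* By the two Cauchy-Schwarz bounds the form is at least this square. *)
have := sqr_ge0 (trace B * a + trace A * b); lra.
Qed.

(** Cross pairs are adjacent in the join, so mixed entries need only be edge values; they are, as
    [edge_val] is closed under sums and products. *)
Lemma feasible_join (G H : graph) (T U : finType) (f : T -> G) (g : U -> H) A B :
  feasible f A -> feasible g B -> feasible (G := join G H)
    (fun i => match i with inl i => inl (f i) | inr i => inr (g i) end)
    (join_kernel A B).
Proof.
move=> [psdA eA nA] [psdB eB nB].
have tA := psd_trace_ge0 psdA; have tB := psd_trace_ge0 psdB.
have sA := psd_total_ge0 psdA; have sB := psd_total_ge0 psdB.
have row (V : finType) (C : V -> V -> R) i : (forall i j, edge_val K (C i j)) ->
  edge_val K (\sum_k C i k) by move=> eC; apply: edge_sum.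
split; first exact: psd_join_kernel.
  case=> [i|i] [j|j] /=; apply: edgeM => //; try (by apply: edge_ge0;
    rewrite ?mulr_ge0 ?sqr_ge0 ?exprn_ge0); by apply: edgeM; exact: row.
case=> [i|i] [j|j] //= ij fij; apply: nonedgeZ; rewrite ?mulr_ge0 ?sqr_ge0 //.
  exact: nA.
exact: nB.
Qed.

Lemma theta_bound_joinl (G H : graph) c :
  theta_bound (join G H) c -> theta_bound G c.
Proof. by apply: theta_bound_hom; exists inl. Qed.

Lemma theta_bound_joinr (G H : graph) c :
  theta_bound (join G H) c -> theta_bound H c.
Proof. by apply: theta_bound_hom; exists inr. Qed.

(** With [p] the left-hand side, the join kernel has total [p * p] and trace
    [trace A * trace B * p]; a factor [p] cancels. *)
Lemma feasible_join_le (G H : graph) (T U : finType) (f : T -> G) (g : U -> H)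
    A B c : theta_bound (join G H) c -> feasible f A -> feasible g B ->
  total A * trace B + total B * trace A <= c * (trace A * trace B).
Proof.
move=> [c0 bJ] fA fB; have := bJ _ _ _ (feasible_join fA fB).
have [psdA _ _] := fA; have [psdB _ _] := fB.
have tA := psd_trace_ge0 psdA; have tB := psd_trace_ge0 psdB.
have sA := psd_total_ge0 psdA; have sB := psd_total_ge0 psdB.
rewrite -bform_total bform_join_kernel.
rewrite (@eq_bform _ _ _ _ (fun=> 1) _ (fun=> 1)) //.
rewrite [X in _ + X + _ <= _](_ : _ = (trace A * trace B * (total A * total B)) *+ 2);
  last by rewrite -!bform_total.
rewrite [X in _ + _ * X <= _](_ : _ = total B); last by rewrite -bform_total.
rewrite bform_total (_ : trace (join_kernel A B) =
  total A * trace B ^+ 2 * trace A + total B * trace A ^+ 2 * trace B); last first.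
  by rewrite {1}/trace big_sumType /= -!mulr_sumr.
set p := total A * trace B + total B * trace A.
have p0 : 0 <= p by rewrite addr_ge0 ?mulr_ge0.
have -> : total A * trace B ^+ 2 * total A
   + (trace A * trace B * (total A * total B)) *+ 2
   + total B * trace A ^+ 2 * total B = p * p by rewrite /p; ring.
have -> : c * (total A * trace B ^+ 2 * trace A + total B * trace A ^+ 2 * trace B) =
   (c * (trace A * trace B)) * p by rewrite /p; ring.
move: p0; rewrite le_eqVlt => /predU1P[<- _|p0]; first by rewrite !mulr_ge0.
by rewrite ler_pM2r.
Qed.

(** Each ratio [total A / trace A] over [G] turns [c - total A / trace A] into a bound for [H],
    hence into a number at least [b]. No optimal kernel has to exist. *)
Lemma theta_bound_join_sub (G H : graph) b c :
  (forall d, theta_bound H d -> b <= d) -> theta_bound (join G H) c ->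
  theta_bound G (c - b).
Proof.
move=> bmin Jc; split=> [|T f A fA].
  by rewrite subr_ge0; apply: bmin; exact: theta_bound_joinr Jc.
have [psdA _ _] := fA; have tA := psd_trace_ge0 psdA.
have [_ /(_ _ _ _ fA) sAc] := theta_bound_joinl Jc.
move: tA; rewrite le_eqVlt => /predU1P[tA|tA].
  by move: sAc; rewrite -tA !mulr0.
suff : b <= c - total A / trace A.
  by rewrite lerBrDl -lerBrDr ler_pdivrMr.
apply: bmin; split=> [|U g B fB]; first by rewrite subr_ge0 ler_pdivrMr.
have := feasible_join_le Jc fA fB => ABc.
rewrite -(ler_pM2r tA) mulrBl mulrBl.
have -> : total A / trace A * trace B * trace A = total A * trace B.
  by field; rewrite gt_eqF.
lra.
Qed.


(** * From kernels to the matrix programs and their suprema *)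

Definition cone_cstr (T : finType) (e : rel T) : set 'M[R]_#|T| :=
  [set M | (forall i j, e (enum_val i) (enum_val j) -> nonedge_val K (M i j)) /\
           (forall i j, edge_val K (M i j))].

Definition cone_theta (T : finType) (e : rel T) : R :=
  max_entry_sum (cone_cstr e).

Lemma psd_formP n (M : 'M[R]_n) : psd M <-> psd_form M.
Proof.
have qE v : (v *m M *m v^T) 0 0 = bform M (v 0) (v 0).
  rewrite mxE [RHS]exchange_big; apply: eq_bigr => j _.
  by rewrite !mxE mulr_suml.
split=> -[sM qM].
  split=> [i j|x]; first by rewrite -{1}sM mxE.
  have := qM (\row_i x i); rewrite qE.
  by rewrite (@eq_bform _ _ _ _ x _ x) // => i; rewrite mxE.
by split=> [|v]; [apply/matrixP => i j; rewrite mxE sM|rewrite qE].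
Qed.

Lemma cone_theta_ge0 (T : finType) (e : rel T) : 0 <= cone_theta e.
Proof.
rewrite /cone_theta /max_entry_sum; set S := [set _ | _ in _].
(* Without a supremum, [sup] defaults to 0. *)
have [supS|/sup_out ->//] := pselect (has_sup S).
have [x Sx] := supS.1; apply: le_trans (ub_le_sup supS.2 Sx).
by case: Sx => M [[/psd_formP psdM _] _] <-; exact: psd_total_ge0.
Qed.

Lemma cone_theta_le (G : graph) (A : {fset compl G}) c :
  theta_bound G c -> cone_theta (induced_adj (A := A)) <= c.
Proof.
move=> [c0 Gc]; rewrite /cone_theta /max_entry_sum; set S := [set _ | _ in _].
have [S0|] := pselect (S !=set0); last by move=> /set0P/negP/negPn/eqP ->; rewrite sup0.
apply: ge_sup => // _ [M [[/psd_formP psdM trM] [nM eM]] <-].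
have := Gc _ (fun i => val (enum_val i) : G) M; rewrite [trace _]trM mulr1.
apply; split=> // i j ij fij; apply: nM.
(* Edges of the complement are the distinct non-adjacent pairs of [G]. *)
rewrite /induced_adj /= /compl_adj /= fij andbT.
by rewrite (inj_eq val_inj) (inj_eq enum_val_inj).
Qed.

(** Pushing forward to [A] merges repeated vertices; dividing by the trace then gives a competitor
    in the supremum. *)
Lemma cone_theta_ge (G : graph) (A : {fset compl G}) (T : finType) (f : T -> G) M :
  feasible f M -> (forall i, f i \in A) ->
  total M <= cone_theta (induced_adj (A := A)) * trace M.
Proof.
move=> fM fA; pose h (i : T) : 'I_#|{: A}| := enum_rank ([` fA i]%fset : A).
pose g (i : 'I_#|{: A}|) : G := val (enum_val i).
have gh i : g (h i) = f i by rewrite /g enum_rankK.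
have hP i j : adj (f i) (f j) -> adj (g (h i)) (g (h j)) by rewrite !gh.
have := feasible_push hP fM; have := trace_push_le hP fM.
rewrite -(total_push h); set N := push h M => tN fN.
have [psdN _ _] := fN; have th0 := cone_theta_ge0 (induced_adj (A := A)).
have tN0 := psd_trace_ge0 psdN.
apply: le_trans (ler_wpM2l th0 tN).
move: tN0; rewrite le_eqVlt => /predU1P[tN0|tN0].
  by rewrite -tN0 mulr0; apply: le_trans (psd_total_le psdN) _; rewrite -tN0 mulr0.
rewrite -ler_pdivrMr // mulrC -totalZ.
have [psdN' eN' nN'] := feasible_scale (ltW (etrans (invr_gt0 _) tN0)) fN.
pose X : 'M[R]_#|{: A}| := \matrix_(i, j) ((trace N)^-1 * N i j).
have XE : fun_of_matrix X = fun i j => (trace N)^-1 * N i j.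
  by apply/funext => i; apply/funext => j; rewrite mxE.
rewrite -XE; apply: ub_le_sup.
  exists #|{: A}|%:R => _ [M' [[/psd_formP psdM' trM'] _] <-].
  by apply: le_trans (psd_total_le psdM') _; rewrite [trace _]trM' mulr1 card_ord.
exists X => //.
split; first split.
- by apply/psd_formP; rewrite XE.
- by rewrite -[LHS]/(trace _) XE traceZ mulVf // gt_eqF.
split=> i j; rewrite XE //; move=> /andP[ij gij].
by apply: nN' => //; apply: contraNneq ij => ->.
Qed.

(** Identifies the extended theta of the complement with the least [theta_bound], so that matrices
    and suprema can be left behind. *)
Lemma extend_cone_theta_leP (G : graph) c :
  (extend_theta cone_theta (compl G) <= c%:E)%E <-> theta_bound G c.
Proof.
rewrite /extend_theta; split; last first.
  move=> Gc; case: ifP => _; first by rewrite lee_fin; exact: cone_theta_le.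
  by apply: ge_ereal_sup => _ [A _ <-]; rewrite lee_fin; exact: cone_theta_le.
(* [P] is the family of vertex sets used by [extend_theta]: the full set alone or all finite sets.
   In both cases every finite list of vertices lies in a member. *)
suff H (P : set {fset compl G}) :
    (forall s : seq (compl G), exists2 A, P A & {subset s <= A}) ->
    (forall A, P A -> cone_theta (induced_adj (A := A)) <= c) -> theta_bound G c.
  case: ifPn => [/asboolP fG|_].
    rewrite lee_fin => Gc.
    apply: (H [set fset_set [set: compl G]]) => [s|_ -> //].
    by exists (fset_set [set: compl G]) => // x _; rewrite in_fset_set // inE.
  move=> /ereal_supP Gc.
  apply: (H setT) => [s|A _]; last by rewrite -lee_fin; apply: Gc; exists A.
  by exists [fset x in s]%fset => // x; rewrite inE.
move=> sP bP; split.
  by have [A PA _] := sP [::]; apply: le_trans (bP A PA); exact: cone_theta_ge0.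
move=> T f M fM; have [A PA fA] := sP [seq f i | i <- enum T].
apply: le_trans (cone_theta_ge fM _) (ler_wpM2r _ (bP A PA)).
  by move=> i; apply: fA; apply: map_f; rewrite mem_enum.
by case: fM => psdM _ _; exact: psd_trace_ge0.
Qed.

Lemma extend_cone_theta_ge0 (G : graph) :
  (0 <= extend_theta cone_theta (compl G))%E.
Proof.
rewrite /extend_theta; case: ifP => _; first by rewrite lee_fin cone_theta_ge0.
apply: (@le_trans _ _ (cone_theta (induced_adj (A := fset0 : {fset compl G})))%:E).
  by rewrite lee_fin cone_theta_ge0.
by apply: ereal_sup_ubound; exists fset0.
Qed.

(** * The sandwich axioms for an arbitrary entry cone *)

Lemma cone_theta_sandwich :
  is_sandwich (fun G : fc_graph => extend_theta cone_theta (compl G)).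
Proof.
(* A finite coloring makes the value real. *)
have fin (G : fc_graph) : exists2 a, extend_theta cone_theta (compl G) = a%:E &
    theta_bound G a /\ forall b, theta_bound G b -> a <= b.
  have [k [c /theta_bound_coloring /extend_cone_theta_leP Gk]] := fc_valP G.
  case E: (extend_theta cone_theta (compl G)) Gk => [a||] //.
    move=> _; exists a => //; split; first by apply/extend_cone_theta_leP; rewrite E.
    by move=> b /extend_cone_theta_leP; rewrite E lee_fin.
  by have := extend_cone_theta_ge0 G; rewrite E.
split.
- move=> G; rewrite extend_cone_theta_ge0 /=.
  by have [a -> _] := fin G; exact: ltry.
- move=> G G0; apply/eqP; rewrite eq_le extend_cone_theta_ge0 andbT.
  apply/extend_cone_theta_leP.
  by apply: (@theta_bound_coloring _ 0 (fun x => match G0 x with end)) => x.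
- move=> G [x0 G1]; apply/eqP; rewrite eq_le; apply/andP; split.
    apply/extend_cone_theta_leP.
    apply: (@theta_bound_coloring _ 1 (fun=> ord0)) => x y.
    by rewrite (G1 x) (G1 y) adj_irrefl.
  have [a -> [[_ Ga] _]] := fin G; rewrite lee_fin.
  have sumU (F : unit -> R) : \sum_i F i = F tt by rewrite (big_pred1 tt) // => -[].
  (* The one-by-one kernel 1 has total and trace 1. *)
  have := Ga unit (fun=> x0) (fun _ _ => 1).
  rewrite /total /trace !sumU mulr1; apply.
  split=> [|i j|[] []//]; last exact: edge_ge0.
  split=> // x; rewrite /bform !sumU mulr1.
  by rewrite -expr2 sqr_ge0.
- move=> G H GH; have [b -> [Hb _]] := fin H.
  by apply/extend_cone_theta_leP; exact: theta_bound_hom Hb.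
- move=> G H.
  have [a -> [Ga amin]] := fin G; have [b -> [Hb bmin]] := fin H.
  have [c -> [Jc cmin]] := fin (fc_join G H).
  rewrite -EFinD; congr _%:E; apply/eqP; rewrite eq_le.
  rewrite cmin /=; last exact: theta_bound_join.
  by rewrite -lerBrDr; apply: amin; exact: theta_bound_join_sub Jc.
Qed.

End Feasible.

(** * The three entry cones *)

Section Cones.
Variable R : realType.

Definition theta_cone : entry_cone R.
Proof.
by exists (fun=> True) (fun x => x = 0) => //;
  [move=> x y -> ->; rewrite addr0|move=> a x _ ->; rewrite mulr0|move=> x ->].
Defined.

Definition theta_prime_cone : entry_cone R.
Proof.
by exists (fun x => 0 <= x) (fun x => x = 0) => //;
  [exact: addr_ge0|exact: mulr_ge0|move=> x y -> ->; rewrite addr0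
  |move=> a x _ ->; rewrite mulr0|move=> x ->].
Defined.

Definition theta_plus_cone : entry_cone R.
Proof.
by exists (fun=> True) (fun x => x <= 0) => //;
  [move=> x y x0 y0; rewrite -[leRHS]addr0 lerD|exact: mulr_ge0_le0].
Defined.

End Cones.

Lemma eq_max_entry_sum (R : realType) n (C D : set 'M[R]_n) :
  (forall M, C M <-> D M) -> max_entry_sum C = max_entry_sum D.
Proof. by move=> CD; congr max_entry_sum; apply/seteqP; split=> M /CD. Qed.

Theorem theorem3p8 (R : realType) :
  is_sandwich (fun G : fc_graph => theta R (compl G)) /\
  is_sandwich (fun G : fc_graph => theta_prime R (compl G)) /\
  is_sandwich (fun G : fc_graph => theta_plus R (compl G)).
Proof.
have eq_theta (K : entry_cone R) (f : forall T : finType, rel T -> R) :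
    (forall T e, @cone_theta R K T e = f T e) ->
    is_sandwich (fun G : fc_graph => extend_theta f (compl G)).
  move=> fE; rewrite (_ : f = @cone_theta R K); first exact: cone_theta_sandwich.
  apply: functional_extensionality_dep => T; apply/funext => e.
  by rewrite fE.
split; [|split].
- apply: (eq_theta (theta_cone R)) => T e; apply: eq_max_entry_sum => M.
  by split=> [[]|].
- by apply: (eq_theta (theta_prime_cone R)) => T e; exact: eq_max_entry_sum.
- apply: (eq_theta (theta_plus_cone R)) => T e; apply: eq_max_entry_sum => M.
  by split=> [[]|].
Qed.
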